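(* Let $N\ge 2$, let $k\in\{1,\ldots,N-1\}$, and let $U\in O(N)$ be a real orthogonal $N\times N$ matrix. For $\theta=(\theta_1,\ldots,\theta_N)\in\mathbb{R}^N$ let $$L(\theta)=U\,\mathrm{diag}(e^{\theta_1},\ldots,e^{\theta_N})\,U^{\top}.$$ Then the $k$-DPP $P^k_{L(\theta)}$ on $\mathcal{X}_k$ with kernel $L(\theta)$ satisfies $$P^{k}_{L(\theta)}(A)=\frac{\sum_{B\in\mathcal{X}_k}\det(U_{A,B})^2\exp\bigl(\sum_{i\in B}\theta_i\bigr)}{e_k(e^{\theta_1},\ldots,e^{\theta_N})},\qquad A\in\mathcal{X}_k,$$ where $U_{A,B}$ is the $k\times k$ submatrix of $U$ with rows in $A$ and columns in $B$. When $U=I_N$, the family $\{P^k_{L(\theta)}:\theta\in\mathbb{R}^N\}$ is a non-minimal exponential family: $$P^{k}_{L(\theta)}(A)=\exp\Bigl(\sum_{i=1}^{N}T_i(A)\theta_i-\psi_k(\theta)\Bigr),\qquad \psi_k(\theta):=\log e_k(e^{\theta_1},\ldots,e^{\theta_N}),\qquad \theta\in\mathbb{R}^N,\ A\in\mathcal{X}_k,$$ where $T(A)=(T_1(A),\ldots,T_N(A))=(\mathbf{1}_{1\in A},\ldots,\mathbf{1}_{N\in A})$ is a non-minimal sufficient statistic. Further (still for $U=I_N$), using the identifiable parametrization $\tilde\theta=(\theta_1-\theta_N,\ldots,\theta_{N-1}-\theta_N)^{\top}\in\mathbb{R}^{N-1}$ yields a minimal exponential family on $\mathcal{X}_k$ with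 natural parameter $\tilde\theta$.
   Context: Let $\mathcal{Y}=\{1,\ldots,N\}$ and $\mathcal{X}_k=\{A\subseteq\mathcal{Y}:|A|=k\}$. For an $N\times N$ matrix $L$ and $A\subseteq\mathcal{Y}$, $L_A$ is the principal submatrix with rows and columns in $A$. For a real symmetric positive semidefinite $L$ put $Z_k(L)=\sum_{A\in\mathcal{X}_k}\det(L_A)$; if $Z_k(L)>0$, the $k$-DPP with kernel $L$ is the probability measure on $\mathcal{X}_k$ given by $P^k_L(A)=\det(L_A)/Z_k(L)$. The $k$-th elementary symmetric polynomial is $e_k(\lambda_1,\ldots,\lambda_N)=\sum_{1\le i_1<\cdots<i_k\le N}\lambda_{i_1}\cdots\lambda_{i_k}$. $I_N$ is the identity matrix, and $\mathbf{1}_{i\in A}$ equals $1$ if $i\in A$ and $0$ otherwise. An exponential family on the finite set $\mathcal{X}_k$ with natural parameter $\xi\in\mathbb{R}^d$ and sufficient statistics $T_1,\ldots,T_d:\mathcal{X}_k\to\mathbb{R}$ is a family of the form $A\mapsto\exp(\sum_{i=1}^d T_i(A)\xi_i-\psi(\xi))$ (up to a fixed base measure). It is non-minimal if its sufficient statistics satisfy a nontrivial affine relation on the sample space, i.e. there are $(a_1,\ldots,a_d)\neq 0$ and $c\in\mathbb{R}$ with $\sum_i a_iT_i(A)=c$ for all $A\in\mathcal{X}_k$; it is minimal if there is no such relation. A parametrization is identifiable if distinct parameter values give distinct distributions. *)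

(* Defs.v *)
(* MathComp + MathComp-Analysis, over an abstract R : realType. *)
From HB Require Import structures.
From mathcomp Require Import all_boot all_order all_algebra.
From mathcomp Require Import all_classical all_reals all_analysis.
(* Not imported: its notations clash with those of MathComp-Analysis. *)
From mathcomp Require mpoly.

Set Implicit Arguments.
Unset Strict Implicit.
Unset Printing Implicit Defensive.

Import Order.TTheory GRing.Theory Num.Theory.
Local Open Scope ring_scope.

Section KSubsets.
Variables N k : nat.

Definition ksubset : finType := {A : {set 'I_N} | #|A| == k}.

Definition kset (A : ksubset) : {set 'I_N} := val A.

(* The increasing enumeration of A, indexed by 'I_k rather than 'I_#|A| so
   that U_(A,B) is a square matrix whose determinant can be taken. *)
Definition kenum (A : ksubset) (i : 'I_k) : 'I_N :=
  enum_val (cast_ord (esym (eqP (valP A))) i).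

End KSubsets.

Definition submx2 (R : Type) (N k : nat) (M : 'M[R]_N) (A B : ksubset N k) :
  'M[R]_k := mxsub (kenum A) (kenum B) M.

Definition principal_submx (R : Type) (N k : nat) (L : 'M[R]_N)
  (A : ksubset N k) : 'M[R]_k := submx2 L A A.

Definition esym_poly (R : realType) (N k : nat) (x : 'I_N -> R) : R :=
  mpoly.meval x (mpoly.mesym N R k).

Definition orthogonal_mx (R : realType) (N : nat) (U : 'M[R]_N) : Prop :=
  U *m U^T = 1%:M.

Definition sym_psd (R : realType) (N : nat) (L : 'M[R]_N) : Prop :=
  L^T = L /\ forall x : 'rV[R]_N, 0 <= (x *m L *m x^T) 0 0.

(* Probability measures on a finite set are given by their mass functions. *)
Definition is_pmf (R : realType) (X : finType) (p : X -> R) : Prop :=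
  (forall x, 0 <= p x) /\ \sum_x p x = 1.

Section KDPP.
Variables (R : realType) (N k : nat).

Definition kdpp_Z (L : 'M[R]_N) : R :=
  \sum_(A : ksubset N k) \det (principal_submx L A).

(* Meaningful when sym_psd L and 0 < kdpp_Z L. *)
Definition kdpp (L : 'M[R]_N) (A : ksubset N k) : R :=
  \det (principal_submx L A) / kdpp_Z L.

End KDPP.

Arguments kdpp_Z {R N} k L.
Arguments kdpp {R N} k L A.

Section ExponentialFamilies.
Variables (R : realType) (X : finType) (d : nat).

(* p is the exponential family with base measure h, sufficient statistics
   x |-> T x 0 i, log-partition psi, and natural parameter ranging over the
   whole of R^d. *)
Definition exp_family (h : X -> R) (T : X -> 'rV[R]_d) (psi : 'rV[R]_d -> R)
    (p : 'rV[R]_d -> X -> R) : Prop :=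
  [/\ forall x, 0 < h x,
      forall xi, is_pmf (p xi)
    & forall xi x,
        p xi x = h x * expR (\sum_(i < d) T x 0 i * xi 0 i - psi xi)].

Definition nonminimal_stat (T : X -> 'rV[R]_d) : Prop :=
  exists (a : 'rV[R]_d) (c : R),
    a != 0 /\ forall x, \sum_(i < d) a 0 i * T x 0 i = c.

Definition minimal_stat (T : X -> 'rV[R]_d) : Prop := ~ nonminimal_stat T.

Definition minimal_exp_family (p : 'rV[R]_d -> X -> R) : Prop :=
  exists (h : X -> R) (T : X -> 'rV[R]_d) (psi : 'rV[R]_d -> R),
    exp_family h T psi p /\ minimal_stat T.

Definition identifiable (p : 'rV[R]_d -> X -> R) : Prop :=
  forall xi xi' : 'rV[R]_d, xi <> xi' -> p xi <> p xi'.

End ExponentialFamilies.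

Section LogLinearKernel.
Variables (R : realType) (N : nat).

Definition Lker (U : 'M[R]_N) (theta : 'rV[R]_N) : 'M[R]_N :=
  U *m diag_mx (map_mx expR theta) *m U^T.

Definition incl_stat (k : nat) (A : ksubset N k) : 'rV[R]_N :=
  \row_(i < N) (i \in kset A)%:R.

Definition log_esym (k : nat) (theta : 'rV[R]_N) : R :=
  ln (esym_poly k (fun i => expR (theta 0 i))).

Definition last_index (hN : (1 < N)%N) : 'I_N :=
  Ordinal (etrans (ltn_predL N) (ltnW hN)).

Definition theta_tilde (hN : (1 < N)%N) (theta : 'rV[R]_N) : 'rV[R]_N.-1 :=
  \row_(i < N.-1)
    (theta 0 (widen_ord (leq_pred N) i) - theta 0 (last_index hN)).

End LogLinearKernel.

Arguments incl_stat {R N k} A.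
Arguments log_esym {R N} k theta.

(* Main.v *)
(* Cauchy-Binet, applied to the factorisation U diag(e^theta) U^T restricted to
   the rows and columns in A, expresses det L_A through the squared minors of U;
   summing over A, the minors disappear since U^T U = I, so the normalising
   constant is e_k.  For U = I the law is exp(sum_(i in A) theta_i) / e_k, which
   is unchanged when a constant is added to theta because |A| = k; subtracting
   theta_N leaves N - 1 parameters.  An affine relation between the remaining
   statistics extends, with coefficient 0 at N, to a function whose sum over
   every k-set is the same; exchanging one element of a k-set for another shows
   that this function is constant, hence 0.  Minimality gives identifiability. *)
Require Import Defs.
From mathcomp Require Import all_boot all_order all_algebra.
From mathcomp Require Import all_fingroup lra.
From mathcomp Require Import all_classical all_reals all_analysis.

Set Implicit Arguments.
Unset Strict Implicit.
Unset Printing Implicit Defensive.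

Import Order.TTheory GRing.Theory Num.Theory.
Local Open Scope ring_scope.

(** * Enumeration of k-sets and sums over them *)

Section KsubsetTheory.
Variables N k : nat.
Implicit Type A : ksubset N k.

Lemma kenum_inj A : injective (kenum A).
Proof. by move=> i j /enum_val_inj /cast_ord_inj. Qed.

Lemma ksetE A : kset A = kenum A @: 'I_k.
Proof.
apply/setP => x; apply/idP/imsetP => [xA | [i _ ->]]; last exact: enum_valP.
exists (cast_ord (eqP (valP A)) (enum_rank_in xA x)); first by rewrite inE.
by rewrite /kenum cast_ordK enum_rankK_in.
Qed.

Lemma big_kenum (S : Type) (idx : S) (op : Monoid.com_law idx) A
    (F : 'I_N -> S) :
  \big[op/idx]_(i < k) F (kenum A i) = \big[op/idx]_(x in kset A) F x.
Proof.
rewrite ksetE big_imset /=; last by move=> i j _ _; apply: kenum_inj.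
by apply: eq_bigl => i; rewrite inE.
Qed.

Lemma big_ksubset (S : Type) (idx : S) (op : Monoid.com_law idx)
    (F : {set 'I_N} -> S) :
  \big[op/idx]_(A : {set 'I_N} | #|A| == k) F A
  = \big[op/idx]_(B : ksubset N k) F (kset B).
Proof.
rewrite (reindex_omap (val : ksubset N k -> _) insub) /=; last first.
  by move=> A cA; rewrite insubT.
by apply: eq_bigl => B; rewrite valK eqxx (valP B).
Qed.

End KsubsetTheory.

(** * The Cauchy-Binet formula *)

Section CauchyBinet.
Variables (R : comPzRingType) (N k : nat).

(** Distributing the products of the Leibniz formula over the sums in the entries of [M *m P] leaves
    one term per choice function [f]. If [f] is not injective, [rowsub f P] has two equal rows and
    the term vanishes. *)
Lemma det_mulmx_ffun (M : 'M[R]_(k, N)) (P : 'M[R]_(N, k)) :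
  \det (M *m P)
  = \sum_(f : {ffun 'I_k -> 'I_N} | injectiveb f)
      (\prod_i M i (f i)) * \det (rowsub f P).
Proof.
transitivity (\sum_(f : {ffun 'I_k -> 'I_N})
    (\prod_i M i (f i)) * \det (rowsub f P)).
  under [RHS]eq_bigr do rewrite big_distrr /=.
  rewrite exchange_big /=; apply: eq_bigr => s _.
  under eq_bigr do rewrite mxE.
  rewrite (bigA_distr_bigA (fun i j => M i j * P j (s i))) big_distrr /=.
  apply: eq_bigr => f _; rewrite big_split mulrCA; congr (_ * (_ * _)).
  by apply: eq_bigr => i _; rewrite mxE.
rewrite (bigID (fun f => injectiveb (f : {ffun _ -> _}))) /=.
rewrite [X in _ + X]big1 ?addr0 // => f /injectivePn [i1 [i2 ne12 eqf]].
by rewrite (determinant_alternate ne12) ?mulr0 // => j; rewrite !mxE eqf.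
Qed.

(** An injection with image [B] is, in exactly one way, a permutation of the positions followed by
    the increasing enumeration of [B]. *)
Lemma reindex_injection_perm (B : ksubset N k)
    (F : {ffun 'I_k -> 'I_N} -> R) :
  \sum_(f : {ffun 'I_k -> 'I_N} | injectiveb f && (f @: 'I_k == kset B)) F f
  = \sum_(s : 'S_k) F [ffun i => kenum B (s i)].
Proof.
(* [rk f i] is the position of [f i] in [B]. The default [i] here, and the default permutation 1 in
   [to_perm], are never reached when [f] is injective with image [B]. *)
pose rk (f : {ffun 'I_k -> 'I_N}) :=
  [ffun i => odflt i [pick j | kenum B j == f i]].
pose to_perm f := insubd (1%g : 'S_k) (rk f).
rewrite (reindex_onto (fun s : 'S_k => [ffun i => kenum B (s i)]) to_perm).
- apply: eq_bigl => s; apply/andP; split; last first.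
    apply/eqP; rewrite -[RHS](valKd (1%g : 'S_k) s); congr insubd; apply/ffunP => j.
    rewrite !ffunE; case: pickP => [l | /(_ (s j))]; rewrite ?eqxx //.
    by move=> /eqP /kenum_inj ->; rewrite -pvalE.
  apply/andP; split.
    by apply/injectiveP => i j; rewrite !ffunE => /kenum_inj /perm_inj.
  rewrite ksetE; apply/eqP/setP => x; apply/imsetP/imsetP => -[i _ ->].
    by exists (s i); rewrite ?inE ?ffunE.
  by exists ((s^-1)%g i); rewrite ?inE ?ffunE ?permKV.
move=> f /andP [/injectiveP inj_f /eqP imf].
have rkE i : kenum B (rk f i) = f i.
  rewrite ffunE; case: pickP => [j /eqP // | no].
  have : f i \in kset B by rewrite -imf imset_f.
  by rewrite ksetE => /imsetP [j _ eq_fi]; move: (no j); rewrite eq_fi eqxx.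
have inj_rk : injectiveb (rk f).
  by apply/injectiveP => i j eq_ij; apply: inj_f; rewrite -!rkE eq_ij.
apply/ffunP => i; rewrite ffunE -rkE; congr kenum.
by rewrite -pvalE /to_perm; congr (fun_of_fin _ i); apply: insubdK.
Qed.

(** Group the injections by their image [B]. Within a group, each permutation [s] contributes its
    sign through the permuted rows of [P], and the signed products of entries of [M] add up to the
    other minor. *)
Lemma Cauchy_Binet (M : 'M[R]_(k, N)) (P : 'M[R]_(N, k)) :
  \det (M *m P)
  = \sum_(B : ksubset N k)
      \det (colsub (kenum B) M) * \det (rowsub (kenum B) P).
Proof.
rewrite det_mulmx_ffun.
rewrite (partition_big (fun f : {ffun 'I_k -> 'I_N} => f @: 'I_k)
           (fun A => #|A| == k)) /=; last first.
  by move=> f /injectiveP inj_f; rewrite card_imset // card_ord.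
rewrite big_ksubset; apply: eq_bigr => B _.
rewrite reindex_injection_perm big_distrl /=; apply: eq_bigr => s _.
have -> : rowsub [ffun i => kenum B (s i)] P = row_perm s (rowsub (kenum B) P).
  by apply/matrixP => i j; rewrite !mxE ffunE.
rewrite row_permE det_mulmx det_perm mulrCA mulrA; congr (_ * _ * _).
by apply: eq_bigr => i _; rewrite !mxE ffunE.
Qed.

End CauchyBinet.

(** * Minors of U D U^T and of orthogonal matrices *)

Section KernelMinors.
Variables (R : comPzRingType) (N k : nat).
Implicit Types (U : 'M[R]_N) (d : 'rV[R]_N) (A B : ksubset N k).

Lemma det_principal_submx_diag U d A :
  \det (principal_submx (U *m diag_mx d *m U^T) A)
  = \sum_(B : ksubset N k)
      (\det (submx2 U A B)) ^+ 2 * \prod_(i in kset B) d 0 i.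
Proof.
rewrite /principal_submx /submx2 mxsub_mul Cauchy_Binet.
apply: eq_bigr => B _; rewrite -mxsubcr -mxsubrc.
have -> : mxsub (kenum A) (kenum B) (U *m diag_mx d)
    = submx2 U A B *m diag_mx (colsub (kenum B) d).
  by rewrite !mul_mx_diag; apply/matrixP => i j; rewrite !mxE.
have -> : mxsub (kenum B) (kenum A) U^T = (submx2 U A B)^T.
  by apply/matrixP => i j; rewrite !mxE.
rewrite det_mulmx det_diag det_tr mulrAC expr2; congr (_ * _).
by rewrite -big_kenum; apply: eq_bigr => i _; rewrite mxE.
Qed.

(** Cauchy-Binet read backwards: the sum is the principal minor of U^T U = I on [B]. *)
Lemma sum_sqr_minors U B :
  U^T *m U = 1%:M -> \sum_(A : ksubset N k) (\det (submx2 U A B)) ^+ 2 = 1.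
Proof.
move=> UTU.
have <- : \det (mxsub (kenum B) (kenum B) (U^T *m U)) = 1.
  rewrite UTU -[RHS](det1 R k); congr determinant.
  by apply/matrixP => i j; rewrite !mxE (inj_eq (@kenum_inj _ _ B)).
rewrite mxsub_mul Cauchy_Binet; apply: eq_bigr => A _.
rewrite expr2 -{1}det_tr; congr (_ * _); congr determinant.
  by apply/matrixP => i j; rewrite !mxE.
by apply/matrixP => i j; rewrite !mxE.
Qed.

End KernelMinors.

(** * The k-DPP with log-linear kernel *)

Section LogLinear.
Variables (R : realType) (N k : nat).
Implicit Types (U : 'M[R]_N) (theta : 'rV[R]_N) (A B : ksubset N k).

Lemma esym_polyE (x : 'I_N -> R) :
  esym_poly k x = \sum_(B : ksubset N k) \prod_(i in kset B) x i.
Proof.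
rewrite /esym_poly /mpoly.mesym.
rewrite (big_morph _ (mpoly.mevalD x) (mpoly.meval0 x)) big_ksubset.
apply: eq_bigr => B _; rewrite (big_morph _ (mpoly.mevalM x) (mpoly.meval1 x)).
by apply: eq_bigr => i _; rewrite mpoly.mevalXU.
Qed.

Lemma esym_poly_expR theta :
  esym_poly k (fun i => expR (theta 0 i))
  = \sum_(B : ksubset N k) expR (\sum_(i in kset B) theta 0 i).
Proof. by rewrite esym_polyE; apply: eq_bigr => B _; rewrite expR_sum. Qed.

Lemma esym_poly_gt0 (x : 'I_N -> R) :
  (k <= N)%N -> (forall i, 0 < x i) -> 0 < esym_poly k x.
Proof.
move=> le_kN x_gt0; rewrite esym_polyE.
(* Positivity needs at least one k-set, which exists because k <= N. *)
have /card_gt0P [A] : (0 < #|[set A : {set 'I_N} | #|A| == k]|)%N.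
  by rewrite card_draws card_ord bin_gt0.
rewrite inE => cA; rewrite (bigD1 (Sub A cA : ksubset N k)) //=.
apply: ltr_wpDr; last by apply: prodr_gt0.
by apply: sumr_ge0 => B _; apply: prodr_ge0 => i _; apply: ltW.
Qed.

Lemma det_principal_Lker U theta A :
  \det (principal_submx (Lker U theta) A)
  = \sum_(B : ksubset N k)
      (\det (submx2 U A B)) ^+ 2 * expR (\sum_(i in kset B) theta 0 i).
Proof.
rewrite det_principal_submx_diag; apply: eq_bigr => B _; congr (_ * _).
by rewrite expR_sum; apply: eq_bigr => i _; rewrite mxE.
Qed.

Lemma det_principal_Lker1 theta A :
  \det (principal_submx (Lker 1%:M theta) A)
  = expR (\sum_(i in kset A) theta 0 i).
Proof.
have -> : principal_submx (Lker 1%:M theta) A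
    = diag_mx (colsub (kenum A) (map_mx expR theta)).
  rewrite /Lker mul1mx trmx1 mulmx1; apply/matrixP => i j.
  by rewrite !mxE (inj_eq (@kenum_inj _ _ A)).
rewrite det_diag expR_sum -big_kenum.
by apply: eq_bigr => i _; rewrite !mxE.
Qed.

Lemma kdpp_Z_Lker U theta : orthogonal_mx U ->
  kdpp_Z k (Lker U theta) = esym_poly k (fun i => expR (theta 0 i)).
Proof.
(* The minors are summed over their row sets, so orthogonality is needed in the form U^T U = I. *)
move=> /mulmx1C UTU; rewrite esym_poly_expR /kdpp_Z.
under eq_bigr do rewrite det_principal_Lker.
rewrite exchange_big; apply: eq_bigr => B _ /=.
by rewrite -big_distrl /= sum_sqr_minors ?mul1r.
Qed.

Lemma sym_psd_Lker U theta : sym_psd (Lker U theta).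
Proof.
split=> [|x]; first by rewrite /Lker !trmx_mul trmxK tr_diag_mx mulmxA.
(* The quadratic form is the sum of e^(theta_i) (x U)_i^2. *)
rewrite /Lker !mulmxA -mulmxA -trmx_mul mul_mx_diag mxE.
apply: sumr_ge0 => i _; rewrite !mxE mulrAC.
by rewrite mulr_ge0 ?expR_ge0 // -expr2 sqr_ge0.
Qed.

Lemma is_pmf_kdpp U theta : orthogonal_mx U -> (k <= N)%N ->
  is_pmf (kdpp k (Lker U theta)).
Proof.
move=> hU le_kN; have Z_gt0 : 0 < kdpp_Z k (Lker U theta).
  by rewrite kdpp_Z_Lker // esym_poly_gt0 // => i; apply: expR_gt0.
split=> [A|]; last by rewrite -big_distrl /= divff ?gt_eqF.
apply: divr_ge0; last exact: ltW.
rewrite det_principal_Lker; apply: sumr_ge0 => B _.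
by rewrite mulr_ge0 ?sqr_ge0 ?expR_ge0.
Qed.

Lemma sum_kset_indicator theta A :
  \sum_(i in kset A) theta 0 i = \sum_(i < N) (i \in kset A)%:R * theta 0 i.
Proof.
by rewrite big_mkcond; apply: eq_bigr => i _; case: ifP; rewrite ?mul1r ?mul0r.
Qed.

Lemma kdpp_Lker1 theta A : (k <= N)%N ->
  kdpp k (Lker 1%:M theta) A
  = expR (\sum_(i < N) (i \in kset A)%:R * theta 0 i - log_esym k theta).
Proof.
move=> le_kN; rewrite /kdpp kdpp_Z_Lker; last first.
  by rewrite /orthogonal_mx mul1mx trmx1.
rewrite det_principal_Lker1 expRB lnK ?sum_kset_indicator //.
by rewrite posrE esym_poly_gt0 // => i; apply: expR_gt0.
Qed.

Lemma exp_family_kdpp_Lker1 : (k <= N)%N ->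
  exp_family (fun _ : ksubset N k => 1) incl_stat (log_esym k)
    (fun theta => kdpp k (Lker 1%:M theta)).
Proof.
move=> le_kN; split=> [A | theta | theta A] //.
  by apply: is_pmf_kdpp => //; rewrite /orthogonal_mx mul1mx trmx1.
rewrite mul1r (eq_bigr (fun i => (i \in kset A)%:R * theta 0 i)).
  exact: kdpp_Lker1.
by move=> i _; rewrite mxE.
Qed.

(** The shift multiplies every principal minor of size k by the same e^(k c), which cancels against
    the normalising constant. *)
Lemma kdpp_Lker1_shift theta (c : R) :
  kdpp k (Lker 1%:M (theta + const_mx c)) = kdpp k (Lker 1%:M theta).
Proof.
have shift A : \det (principal_submx (Lker 1%:M (theta + const_mx c)) A)
    = \det (principal_submx (Lker 1%:M theta) A) * expR (c *+ k).
  rewrite !det_principal_Lker1 -expRD; congr expR.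
  under eq_bigr do rewrite !mxE.
  by rewrite big_split /= sumr_const (eqP (valP A)).
apply/funext => A; rewrite /kdpp /kdpp_Z shift.
under eq_bigr do rewrite shift.
by rewrite -big_distrl /= -mulf_div divff ?mulr1 // gt_eqF ?expR_gt0.
Qed.

Lemma nonminimal_incl_stat : (0 < N)%N ->
  nonminimal_stat (incl_stat : ksubset N k -> 'rV[R]_N).
Proof.
move=> N_gt0; exists (const_mx 1), k%:R; split.
  apply/eqP => /rowP /(_ (Ordinal N_gt0)); rewrite !mxE.
  by apply/eqP; rewrite oner_eq0.
move=> A; transitivity (\sum_(i in kset A) (const_mx 1 : 'rV[R]_N) 0 i).
  by rewrite sum_kset_indicator; apply: eq_bigr => i _; rewrite !mxE mulrC.
by under eq_bigr do rewrite mxE; rewrite sumr_const (eqP (valP A)).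
Qed.

(* For i <> j choose a (k-1)-set C avoiding both; then C + i and C + j are
   k-sets, and comparing the constant sums over them gives a i = a j. *)
Lemma const_ksum_eq (a : 'I_N -> R) (c : R) : (0 < k < N)%N ->
  (forall A, \sum_(i in kset A) a i = c) -> forall i j, a i = a j.
Proof.
move=> /andP [k_gt0 lt_kN] sum_a i j; have [-> // | ne_ij] := eqVneq i j.
have /card_gt0P [C] : (0 < #|[set C : {set 'I_N} |
    C \subset ~: [set i; j] & #|C| == k.-1]|)%N.
  rewrite cards_draws cardsCs finset.setCK cards2 ne_ij card_ord bin_gt0.
  by rewrite -subn1 -subSS leq_sub2r.
rewrite inE finset.subsetC finset.subUset !finset.sub1set !inE -!andbA => /and3P [iC jC /eqP cC].
have sum_a1 l : l \notin C -> a l + \sum_(i in C) a i = c.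
  move=> lC; have card_lC : #|l |: C| == k by rewrite cardsU1 lC cC add1n prednK.
  by rewrite -(sum_a (Sub (l |: C) card_lC)) /kset /= big_setU1.
by apply: (addIr (\sum_(i in C) a i)); rewrite !sum_a1.
Qed.

End LogLinear.

(** * Minimality and identifiability *)

Section ExpFamilies.
Variables (R : realType) (X : finType) (d : nat).

(** If [xi] and [xi'] give the same law, comparing exponents yields an affine relation between the
    statistics with nonzero coefficient vector [xi - xi']. *)
Lemma minimal_stat_identifiable (h : X -> R) (T : X -> 'rV[R]_d)
    (psi : 'rV[R]_d -> R) (p : 'rV[R]_d -> X -> R) :
  exp_family h T psi p -> minimal_stat T -> identifiable p.
Proof.
case=> h_gt0 _ pE minT xi xi' ne_xi eq_p; apply: minT.
exists (xi - xi'), (psi xi - psi xi'); split; first by rewrite subr_eq0; apply/eqP.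
move=> x; have := congr1 (fun q => q x) eq_p; rewrite !pE.
move=> /(mulfI (lt0r_neq0 (h_gt0 x))) /expR_inj eqx.
have : \sum_(i < d) T x 0 i * xi 0 i - \sum_(i < d) T x 0 i * xi' 0 i
    = psi xi - psi xi'.
  by lra.
move=> <-; rewrite -sumrB; apply: eq_bigr => i _.
by rewrite !mxE mulrC mulrBr.
Qed.

End ExpFamilies.

(** * The parametrization by theta_i - theta_N *)

Section Reparametrization.
Variables (R : realType) (N : nat) (hN : (1 < N)%N).
Implicit Types (t a : 'rV[R]_N.-1) (theta : 'rV[R]_N).

(** A right inverse of [theta_tilde]: it picks the representative with last coordinate 0, the one
    index where [insub] fails. *)
Definition append0 t : 'rV[R]_N :=
  \row_(j < N) oapp (t 0) 0 (insub (val j)).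

Lemma append0_widen t i : append0 t 0 (widen_ord (leq_pred N) i) = t 0 i.
Proof. by rewrite mxE (valK i). Qed.

Lemma append0_last t : append0 t 0 (last_index hN) = 0.
Proof. by rewrite mxE insubF //= ltnn. Qed.

Lemma big_last_index (F : 'I_N -> R) :
  \sum_(j < N) F j
  = \sum_(i < N.-1) F (widen_ord (leq_pred N) i) + F (last_index hN).
Proof.
case: N hN F => // n hn F; rewrite big_ord_recr /=; congr (_ + F _).
  by apply: eq_bigr => i _; congr F; apply: val_inj.
exact: val_inj.
Qed.

Lemma sum_append0 (f : 'I_N -> R) t :
  \sum_(j < N) f j * append0 t 0 j
  = \sum_(i < N.-1) f (widen_ord (leq_pred N) i) * t 0 i.
Proof.
rewrite big_last_index append0_last mulr0 addr0.
by apply: eq_bigr => i _; rewrite append0_widen.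
Qed.

Lemma append0K : cancel append0 (theta_tilde hN : 'rV[R]_N -> _).
Proof.
by move=> t; apply/rowP => i; rewrite mxE append0_last subr0 append0_widen.
Qed.

(** With shift invariance, this shows that the law depends on [theta] only through [theta_tilde]. *)
Lemma append0_theta_tilde theta :
  append0 (theta_tilde hN theta)
  = theta + const_mx (- theta 0 (last_index hN)).
Proof.
apply/rowP => j; rewrite !mxE; case: insubP => [i _ ij | ge_j] /=.
  by rewrite mxE; congr (theta 0 _ - _); apply: val_inj.
suff -> : j = last_index hN by rewrite subrr.
apply/val_inj/eqP; rewrite eqn_leq /= andbC leqNgt; apply/andP; split=> //.
by rewrite -ltnS prednK ?ltn_ord // ltnW.
Qed.

Variable k : nat.

Definition reduced_kdpp t : ksubset N k -> R :=
  kdpp k (Lker 1%:M (append0 t)).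

Definition reduced_stat (A : ksubset N k) : 'rV[R]_N.-1 :=
  \row_(i < N.-1) (widen_ord (leq_pred N) i \in kset A)%:R.

Lemma exp_family_reduced_kdpp : (k <= N)%N ->
  exp_family (fun=> 1) reduced_stat (fun t => log_esym k (append0 t))
    reduced_kdpp.
Proof.
move=> le_kN; have [_ pmf _] := exp_family_kdpp_Lker1 R le_kN.
split=> [// | t | t A]; first exact: pmf.
rewrite mul1r (eq_bigr (fun i =>
    (widen_ord (leq_pred N) i \in kset A)%:R * t 0 i)).
  rewrite -(sum_append0 (fun j => (j \in kset A)%:R)).
  exact: kdpp_Lker1.
by move=> i _; rewrite mxE.
Qed.

Lemma minimal_reduced_stat : (0 < k < N)%N -> minimal_stat reduced_stat.
Proof.
move=> lt_kN [a [c [/negP a_neq0 sum_a]]]; apply: a_neq0.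
(* Padding with 0 does not change the affine relation, which thus becomes a constant sum over
   k-sets; the common value of the coefficients is then read off at the last index. *)
have eq_a : forall i j, append0 a 0 i = append0 a 0 j.
  apply: (const_ksum_eq lt_kN (c := c)) => A.
  rewrite sum_kset_indicator sum_append0 -(sum_a A).
  by apply: eq_bigr => i _; rewrite mxE mulrC.
apply/eqP/rowP => i; rewrite -append0_widen (eq_a _ (last_index hN)).
by rewrite append0_last mxE.
Qed.

End Reparametrization.

Theorem proposition1 (R : realType) (N k : nat) (hN : (1 < N)%N)
    (hk0 : (0 < k)%N) (hkN : (k < N)%N) (U : 'M[R]_N)
    (hU : orthogonal_mx U) :
  (* the k-DPP with kernel L(theta) is well defined and is given by ... *)
  (forall theta : 'rV[R]_N,
     [/\ sym_psd (Lker U theta), 0 < kdpp_Z k (Lker U theta),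
         is_pmf (kdpp k (Lker U theta))
       & forall A : ksubset N k,
           kdpp k (Lker U theta) A =
           (\sum_(B : ksubset N k)
               (\det (submx2 U A B)) ^+ 2 *
               expR (\sum_(i in kset B) theta 0 i))
           / esym_poly k (fun i => expR (theta 0 i))])
  /\
  (U = 1%:M ->
   (* non-minimal exponential family, statistic T(A) = (1_{i in A})_i *)
   [/\ forall (theta : 'rV[R]_N) (A : ksubset N k),
         kdpp k (Lker U theta) A =
         expR (\sum_(i < N) (i \in kset A)%:R * theta 0 i - log_esym k theta),
       exp_family (fun _ : ksubset N k => 1) incl_stat (log_esym k)
         (fun theta => kdpp k (Lker U theta)),
       nonminimal_stat (incl_stat : ksubset N k -> 'rV[R]_N)
     & (* reparametrization by theta_tilde, which ranges over R^(N-1) *)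
       (forall t : 'rV[R]_N.-1, exists theta, theta_tilde hN theta = t) /\
       exists Q : 'rV[R]_N.-1 -> ksubset N k -> R,
         [/\ forall theta : 'rV[R]_N,
               kdpp k (Lker U theta) = Q (theta_tilde hN theta),
             identifiable Q
           & minimal_exp_family Q]]).
Proof.
have le_kN := ltnW hkN; have lt0kN : (0 < k < N)%N by rewrite hk0.
split=> [theta | ->].
  split; first exact: sym_psd_Lker.
  - by rewrite kdpp_Z_Lker // esym_poly_gt0 // => i; apply: expR_gt0.
  - exact: is_pmf_kdpp.
  - by move=> A; rewrite /kdpp kdpp_Z_Lker // det_principal_Lker.
split=> [theta A||| ].
- exact: kdpp_Lker1.
- exact: exp_family_kdpp_Lker1.
- exact/nonminimal_incl_stat/ltnW.
split=> [t|]; first by exists (append0 t); apply: append0K.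
exists (@reduced_kdpp R N k).
have expQ := exp_family_reduced_kdpp R hN le_kN.
have minT := minimal_reduced_stat (R := R) hN lt0kN.
split=> [theta||].
- rewrite /reduced_kdpp append0_theta_tilde; apply/esym.
  exact: kdpp_Lker1_shift.
- exact: minimal_stat_identifiable expQ minT.
- by exists (fun=> 1), (@reduced_stat R N k), (fun t => log_esym k (append0 t)).
Qed.
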